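(* Let $\star$ be a finite-type star operation on a domain $R$, $M$ a $\star$-super potent maximal $\star$-ideal of $R$, and $I$ a $\star$-super rigid ideal of $R$ contained in $M$. (1) If $A$ is a finitely generated ideal for which $A^{\star}\supseteq I$, then $A$ is $\star$-super rigid. (2) If $J$ is a $\star$-super rigid ideal contained in $M$, then $I\subseteq J^{\star}$ or $J\subseteq I^{\star}$. (3) If $J$ is a $\star$-super rigid ideal contained in $M$, then $IJ$ is also a $\star$-super rigid ideal. (4) $I^n$ is $\star$-super rigid for each positive integer $n$. (5) If $R$ is local with maximal ideal $M$, then $I$ is comparable (under inclusion) to each ideal of $R$, and $\bigcap_{n=1}^{\infty}I^n$ is prime. (6) $I^{\star}=IR_M\cap R$. (7) $\bigcap_{n=1}^{\infty}(I^n)^{\star}$ is prime. (8) If $P$ is a prime ideal of $R$ with $P\subseteq M$ and $I\nsubseteq P$, then $P\subseteq\bigcap_{n=1}^{\infty}(I^n)^{\star}$.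
   Context: For a domain $R$ with quotient field $K$, let $\mathcal F(R)$ be the set of nonzero fractional ideals of $R$. A star operation on $R$ is a map $\star:\mathcal F(R)\to\mathcal F(R)$, $A\mapsto A^\star$, such that for all $A,B\in\mathcal F(R)$ and $c\in K\setminus(0)$: $(cA)^\star=cA^\star$ and $R^\star=R$; $A\subseteq A^\star$, and $A\subseteq B$ implies $A^\star\subseteq B^\star$; $(A^\star)^\star=A^\star$. It has finite type if, for every $A\in\mathcal F(R)$, $A^\star=\bigcup J^\star$, the union over all nonzero finitely generated subideals $J$ of $A$. For $I\in\mathcal F(R)$ put $I^{-1}=\{x\in K: xI\subseteq R\}$. Let $\star$ be a finite-type star operation on $R$. A $\star$-ideal is a nonzero ideal $I$ with $I^\star=I$. A maximal $\star$-ideal is an ideal of $R$ maximal among the proper $\star$-ideals (it is prime). A nonzero ideal $I$ is $\star$-invertible if $(II^{-1})^\star=R$. A nonzero finitely generated ideal $I$ of $R$ is $\star$-rigid if it is contained in exactly one maximal $\star$-ideal, and $\star$-super rigid if, in addition, every finitely generated ideal $J\supseteq I$ of $R$ is $\star$-invertible. A maximal $\star$-ideal is $\star$-super potent if it contains a $\star$-super rigid ideal. ''Local'' means having a unique maximal ideal (not necessarily Noetherian).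
   Formalization: In (1), A is taken to be a nonzero ideal of R and the hypothesis A^⋆ ≠ R is added: as written (1) fails for A = R, which contains I but lies in no maximal ⋆-ideal, and it fails whenever A^⋆ = R. *)

(* Defs.v *)
From mathcomp Require Import all_boot all_algebra.
From mathcomp Require Import boolp classical_sets.

Set Implicit Arguments.
Unset Strict Implicit.
Unset Printing Implicit Defensive.

Import GRing.Theory.
Local Open Scope ring_scope.
Local Open Scope classical_set_scope.

(* Fractional and integral ideals of R are both subsets of the quotient field *)
(* {fraction R}; R itself is identified with its image [dom R] there.         *)

Section Ideals.
Variable R : idomainType.
Local Notation K := {fraction R}.
Implicit Types (A B I J M N P : set K) (c x y : K) (a d : R).

Definition dom : set K := range (@tofrac R).

Definition submodule A : Prop :=
  [/\ A 0, forall x y, A x -> A y -> A (x + y)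
    & forall a x, A x -> A (tofrac a * x)].

Definition nonzero A : Prop := exists2 x, A x & x != 0.

(* The elements of F(R): nonzero submodules of K with a common denominator. *)
Definition fractional A : Prop :=
  [/\ submodule A, nonzero A
    & exists2 d, d != 0 & forall x, A x -> dom (tofrac d * x)].

Definition span_sub (s : seq K) : set K :=
  [set x | exists a : 'I_(size s) -> R,
             x = \sum_(i < size s) tofrac (a i) * s`_i].

Definition fin_gen A : Prop := exists s : seq K, A = span_sub s.

Definition scale_sub c A : set K := [set c * x | x in A].

(* The submodule generated by all products x * y, as finite sums of them. *)
Definition mul_sub A B : set K :=
  [set z | exists n (x y : 'I_n -> K),
     (forall i, A (x i) /\ B (y i)) /\ z = \sum_(i < n) x i * y i].

Definition exp_sub A (n : nat) : set K := iter n (mul_sub A) dom.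

Definition inv_sub A : set K := [set x | forall y, A y -> dom (x * y)].

Definition ideal A : Prop := submodule A /\ A `<=` dom.

Definition prime_ideal P : Prop :=
  [/\ ideal P, P <> dom
    & forall x y, dom x -> dom y -> P (x * y) -> P x \/ P y].

Definition maximal_ideal M : Prop :=
  [/\ ideal M, M <> dom & forall N, ideal N -> N <> dom -> M `<=` N -> N = M].

Definition local_with_maximal_ideal M : Prop :=
  forall N, maximal_ideal N <-> N = M.

(* The localization of R at a prime P, inside K. *)
Definition localization P : set K :=
  [set x | exists a d : R, ~ P (tofrac d) /\ x = tofrac a / tofrac d].

End Ideals.

Arguments dom R : clear implicits.

(* A star operation is a map on F(R); [star_fun] is extended to all subsets   *)
(* of K, and its values outside F(R) are unconstrained, so it must only be    *)
(* applied to nonzero fractional ideals.                                      *)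
Record star_operation (R : idomainType) := StarOperation {
  star_fun :> set {fraction R} -> set {fraction R};
  star_fractional : forall A, fractional A -> fractional (star_fun A);
  star_scale : forall (c : {fraction R}) A, c != 0 -> fractional A ->
    star_fun (scale_sub c A) = scale_sub c (star_fun A);
  star_dom : star_fun (dom R) = dom R;
  star_ext : forall A, fractional A -> A `<=` star_fun A;
  star_mono : forall A B, fractional A -> fractional B ->
    A `<=` B -> star_fun A `<=` star_fun B;
  star_idem : forall A, fractional A -> star_fun (star_fun A) = star_fun A
}.

Section Star.
Variables (R : idomainType) (star : star_operation R).
Local Notation K := {fraction R}.
Implicit Types (A B I J M N P : set K).

Definition finite_type : Prop :=
  forall A, fractional A ->
    star A = \bigcup_(J in [set J : set K | [/\ fin_gen J, nonzero J & J `<=` A]])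
               star J.

Definition star_ideal I : Prop := [/\ ideal I, nonzero I & star I = I].

Definition maximal_star_ideal M : Prop :=
  [/\ star_ideal M, M <> dom R
    & forall N, star_ideal N -> N <> dom R -> M `<=` N -> N = M].

Definition star_invertible I : Prop :=
  [/\ ideal I, nonzero I & star (mul_sub I (inv_sub I)) = dom R].

Definition star_rigid I : Prop :=
  [/\ ideal I, nonzero I, fin_gen I
    & exists! M, maximal_star_ideal M /\ I `<=` M].

Definition star_super_rigid I : Prop :=
  star_rigid I /\
  forall J, ideal J -> fin_gen J -> I `<=` J -> star_invertible J.

Definition star_super_potent M : Prop :=
  maximal_star_ideal M /\ exists2 I, star_super_rigid I & I `<=` M.

End Star.

(* Main.v *)
Require Import Defs.
From mathcomp Require Import all_boot all_algebra.
From mathcomp Require Import boolp classical_sets.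
From mathcomp Require Import ring.

(** All of (1)-(8) rest on one observation: super rigidity is a condition at M
alone.  If M is the only maximal star-ideal that can contain C, then C is
star-invertible exactly when c y lies outside M for a single pair c in C and
y in C^-1: the ideal C C^-1 then lies in no maximal star-ideal, and Zorn's
lemma, which applies because star has finite type, makes its star closure R
([star_eq_dom], [super_rigid_atE]).  An invertibility hypothesis is thus used
as one element outside M, and proved by exhibiting one.

Write S for a super rigid ideal at M.  Two transfer principles carry the rest.
- If only M can contain J, if u is outside M and u x lies in J, then x lies in
  the star closure of J: the ideal of all r with x r in J contains J and u, so
  no maximal star-ideal contains it ([mem_star_of_local]).
- If a in R is not in the star closure of S, then u S is contained in a R for
  some u outside M ([super_rigid_at_mul_sub_principal]).  Indeed S + aR is
  invertible at M, and s + ra with y (s + ra) outside M leaves only the choice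
  u = y a, since y s outside M would put a in the closure of S by the first
  principle.

Together they show that S is comparable, up to star closure, with every A that
only M can contain: an element of A outside the closure of S moves S into A
([super_rigid_at_comparable]).  This gives (2), and it reduces the
invertibility of an ideal C containing IJ to the case where C is inside the
closure of I.  There, y in I^-1 with i y outside M carries C to the integral
ideal y C, and J + y C is invertible at M because it contains J
([super_rigid_at_mul]).  Statement (4) follows by induction, and (6) is the
first principle combined with one element i y outside M.

For (7), if a and b avoid the intersection, then u I^m is in aR and v I^n is
in bR with u, v outside M, so that ab in the intersection forces uv I^k, for
k = m + n, into the closure of I^(k+1).  Multiplying by an inverse of I^k at M
puts uv in M, against the primality of M.  For (8), an element p of P outside
the closure of I^n gives u I^n inside pR, which is inside P, with u outside P;
then I would be inside P.

Statement (5) is the case of the identity star operation.  In a local domain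
its only maximal star-ideal is M, and since super rigidity is a condition at
M, I is super rigid for the identity as well ([local_super_rigid_at]). *)

Set Implicit Arguments.
Unset Strict Implicit.
Unset Printing Implicit Defensive.

Import GRing.Theory.
Local Open Scope ring_scope.
Local Open Scope classical_set_scope.

(** * Submodules of the quotient field *)

Section Submodules.
Variable R : idomainType.
Local Notation K := {fraction R}.
Local Notation D := (dom R).
Implicit Types (A B C G I J M : set K) (x y z : K) (s t : seq K).

Lemma dom_tofrac (a : R) : D (tofrac a).
Proof. by exists a. Qed.

Lemma dom0 : D 0.
Proof. by exists 0 => //; rewrite tofrac0. Qed.

Lemma dom1 : D 1.
Proof. by exists 1 => //; rewrite tofrac1. Qed.

Lemma domD x y : D x -> D y -> D (x + y).
Proof. by move=> [a _ <-] [b _ <-]; exists (a + b) => //; rewrite tofracD. Qed.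

Lemma domM x y : D x -> D y -> D (x * y).
Proof. by move=> [a _ <-] [b _ <-]; exists (a * b) => //; rewrite tofracM. Qed.

Lemma submodule0 A : submodule A -> A 0.
Proof. by case. Qed.

Lemma submoduleD A x y : submodule A -> A x -> A y -> A (x + y).
Proof. by case=> _ + _; apply. Qed.

Lemma submoduleM A r x : submodule A -> D r -> A x -> A (r * x).
Proof. by move=> [_ _ h] [a _ <-]; apply: h. Qed.

Lemma submodule_sum A n (f : 'I_n -> K) :
  submodule A -> (forall i, A (f i)) -> A (\sum_(i < n) f i).
Proof.
move=> [A0 AD _] Af; apply: (big_ind A) => // i _; exact: Af.
Qed.

Lemma dom_submodule : submodule D.
Proof.
split; [exact: dom0 | exact: domD |].
by move=> a x; apply: domM; exact: dom_tofrac.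
Qed.

Lemma dom_ideal : ideal D.
Proof. by split=> //; exact: dom_submodule. Qed.

Lemma idealM A r x : ideal A -> D r -> A x -> A (r * x).
Proof. by case=> sA _; exact: submoduleM. Qed.

Lemma ideal_eq_dom A : ideal A -> A 1 -> A = D.
Proof.
move=> idA A1; apply/seteqP; split; first by case: idA.
by move=> x Dx; rewrite -[x]mulr1; apply: idealM.
Qed.

(** Lets the minimality of spans and products be applied one factor at a time:
an inclusion about x * y, for a fixed y, becomes an inclusion into this
submodule. *)
Lemma preim_submodule A y : submodule A -> submodule [set x | A (y * x)].
Proof.
move=> [A0 AD AM]; split=> [|x z /= ? ?|a x /= ?].
- by rewrite /= mulr0.
- by rewrite mulrDr; apply: AD.
- by rewrite mulrCA; apply: AM.
Qed.

Lemma span_submodule s : submodule (span_sub s).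
Proof.
split.
- exists (fun=> 0); rewrite big1 // => i _; by rewrite tofrac0 mul0r.
- move=> x y [a ->] [b ->]; exists (fun i => a i + b i).
  by rewrite -big_split; apply: eq_bigr => i _; rewrite tofracD mulrDl.
- move=> c x [a ->]; exists (fun i => c * a i).
  by rewrite mulr_sumr; apply: eq_bigr => i _; rewrite tofracM mulrA.
Qed.

Lemma mem_span s x : x \in s -> span_sub s x.
Proof.
move=> /(nthP 0) [i ilt <-].
exists (fun j => if j == Ordinal ilt then 1 else 0).
rewrite (bigD1 (Ordinal ilt)) //= eqxx tofrac1 mul1r big1 ?addr0 // => j.
by move=> /negbTE ->; rewrite tofrac0 mul0r.
Qed.

(** Together with [span_submodule] and [mem_span], this characterizes
[span_sub s] as the least submodule containing [s], which is how finite
generation of sums, products and multiples is proved below. *)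
Lemma span_min s G :
  submodule G -> (forall x, x \in s -> G x) -> span_sub s `<=` G.
Proof.
move=> subG Gs x [a ->]; apply: submodule_sum => // i.
by apply: submoduleM => //; [exact: dom_tofrac | apply/Gs/mem_nth].
Qed.

Definition add_sub A B : set K := [set z | exists x y, [/\ A x, B y & z = x + y]].

Lemma add_sub_submodule A B :
  submodule A -> submodule B -> submodule (add_sub A B).
Proof.
move=> [A0 AD AM] [B0 BD BM]; split.
- by exists 0, 0; rewrite addr0.
- move=> _ _ [x [y [Ax By ->]]] [x' [y' [Ax' By' ->]]].
  by exists (x + x'), (y + y'); rewrite addrACA; split; auto.
- move=> a _ [x [y [Ax By ->]]].
  by exists (tofrac a * x), (tofrac a * y); rewrite mulrDr; split; auto.
Qed.

Lemma add_sub_ideal A B : ideal A -> ideal B -> ideal (add_sub A B).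
Proof.
move=> [sA AD] [sB BD]; split; first exact: add_sub_submodule.
by move=> _ [x [y [/AD ? /BD ? ->]]]; apply: domD.
Qed.

Lemma add_subl A B : submodule B -> A `<=` add_sub A B.
Proof. by move=> [B0 _ _] x Ax; exists x, 0; rewrite addr0. Qed.

Lemma add_subr A B : submodule A -> B `<=` add_sub A B.
Proof. by move=> [A0 _ _] x Bx; exists 0, x; rewrite add0r. Qed.

Lemma fin_gen_add A B : fin_gen A -> fin_gen B -> fin_gen (add_sub A B).
Proof.
move=> [s ->] [t ->]; exists (s ++ t); apply/seteqP; split.
- move=> _ [x [y [sx ty ->]]].
  apply: submoduleD; first exact: span_submodule.
  + apply: span_min sx; first exact: span_submodule.
    by move=> u us; apply: mem_span; rewrite mem_cat us.
  + apply: span_min ty; first exact: span_submodule.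
    by move=> u ut; apply: mem_span; rewrite mem_cat ut orbT.
- apply: span_min; first by apply: add_sub_submodule; exact: span_submodule.
  move=> x; rewrite mem_cat => /orP[] /mem_span.
  + by apply: add_subl; exact: span_submodule.
  + by apply: add_subr; exact: span_submodule.
Qed.

Definition principal x : set K := [set r * x | r in D].

Lemma principal_submodule x : submodule (principal x).
Proof.
split.
- by exists 0; [exact: dom0 | rewrite mul0r].
- move=> _ _ [r Dr <-] [s Ds <-].
  by exists (r + s); [exact: domD | rewrite mulrDl].
- move=> a _ [r Dr <-]; exists (tofrac a * r); last by rewrite mulrA.
  by apply: domM => //; exact: dom_tofrac.
Qed.

Lemma mem_principal x : principal x x.
Proof. by exists 1; [exact: dom1 | rewrite mul1r]. Qed.

Lemma principal_min A x : submodule A -> A x -> principal x `<=` A.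
Proof. by move=> sA Ax _ [r Dr <-]; exact: submoduleM. Qed.

Lemma principal_ideal x : D x -> ideal (principal x).
Proof.
move=> Dx; split; first exact: principal_submodule.
by apply: principal_min => //; exact: dom_submodule.
Qed.

Lemma fin_gen_principal x : fin_gen (principal x).
Proof.
exists [:: x]; apply/seteqP; split.
- apply: principal_min; first exact: span_submodule.
  by apply: mem_span; rewrite mem_head.
- apply: span_min; first exact: principal_submodule.
  by move=> y; rewrite inE => /eqP ->; exact: mem_principal.
Qed.

Lemma scale_submodule c A : submodule A -> submodule (scale_sub c A).
Proof.
move=> [A0 AD AM]; split.
- by exists 0; rewrite ?mulr0.
- by move=> _ _ [u Au <-] [v Av <-]; exists (u + v); [exact: AD | rewrite mulrDr].
- by move=> a _ [u Au <-]; exists (tofrac a * u); [exact: AM | rewrite mulrCA].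
Qed.

Lemma fin_gen_scale y A : fin_gen A -> fin_gen (scale_sub y A).
Proof.
move=> [s ->]; exists [seq y * x | x <- s]; apply/seteqP; split.
- move=> _ [x sx <-].
  apply: (@span_min s [set x | span_sub [seq y * x | x <- s] (y * x)]) sx.
    by apply: preim_submodule; exact: span_submodule.
  by move=> u us; apply/mem_span/map_f.
- apply: span_min; first by apply: scale_submodule; exact: span_submodule.
  by move=> _ /mapP [u us ->]; exists u => //; exact: mem_span.
Qed.

Lemma mem_mul_sub A B x y : A x -> B y -> mul_sub A B (x * y).
Proof.
move=> Ax By; exists 1%N, (fun=> x), (fun=> y).
by split=> //; rewrite big_ord1.
Qed.

Lemma mul_sub_min A B G :
  G 0 -> (forall x y, G x -> G y -> G (x + y)) ->
  (forall x y, A x -> B y -> G (x * y)) -> mul_sub A B `<=` G.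
Proof.
move=> G0 GD GM _ [n [x [y [AB ->]]]].
by apply: (big_ind G) => // i _; have [? ?] := AB i; apply: GM.
Qed.

Lemma mul_sub_submodule A B : submodule A -> submodule (mul_sub A B).
Proof.
move=> sA; split.
- by exists 0%N, (fun=> 0), (fun=> 0); split=> [[]//|]; rewrite big_ord0.
- move=> _ _ [m [x [y [AB ->]]]] [n [x' [y' [AB' ->]]]].
  exists (m + n)%N.
  exists (fun i => match split i with inl j => x j | inr k => x' k end).
  exists (fun i => match split i with inl j => y j | inr k => y' k end).
  split; first by move=> i; case: (split i).
  rewrite big_split_ord; congr (_ + _); apply: eq_bigr => i _.
  + by rewrite (unsplitK (inl i)).
  + by rewrite (unsplitK (inr i)).
- move=> a _ [n [x [y [AB ->]]]].
  exists n, (fun i => tofrac a * x i), y; split.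
    by move=> i; have [? ?] := AB i; split=> //; apply: submoduleM => //; exact: dom_tofrac.
  by rewrite mulr_sumr; apply: eq_bigr => i _; rewrite mulrA.
Qed.

Lemma mul_sub_subl A B : submodule A -> B `<=` D -> mul_sub A B `<=` A.
Proof.
move=> sA BD.
apply: mul_sub_min; [exact: submodule0 | by move=> x y; exact: submoduleD |].
by move=> x y Ax /BD Dy; rewrite mulrC; apply: submoduleM.
Qed.

Lemma mul_sub_ideal A B : ideal A -> B `<=` D -> ideal (mul_sub A B).
Proof.
move=> [sA AD] BD; split; first exact: mul_sub_submodule.
by apply: subset_trans AD; exact: mul_sub_subl.
Qed.

Lemma mul_sub_nonzero A B : nonzero A -> nonzero B -> nonzero (mul_sub A B).
Proof.
move=> [x Ax x0] [y By y0]; exists (x * y); first exact: mem_mul_sub.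
by rewrite mulf_neq0.
Qed.

Lemma fin_gen_mul A B : fin_gen A -> fin_gen B -> fin_gen (mul_sub A B).
Proof.
move=> [s ->] [t ->]; exists [seq x * y | x <- s, y <- t]; apply/seteqP; split.
- set G := span_sub [seq _ | _ <- _, _ <- _].
  have sG : submodule G by exact: span_submodule.
  apply: mul_sub_min; [exact: submodule0 | by move=> x y; exact: submoduleD |].
  move=> x y sx; apply: (@span_min t [set y | G (x * y)]).
    exact: preim_submodule.
  move=> v vt /=; rewrite mulrC; apply: (@span_min s [set x | G (v * x)]) sx.
    exact: preim_submodule.
  by move=> u us /=; rewrite mulrC; apply/mem_span/allpairs_f.
- apply: span_min; first by apply: mul_sub_submodule; exact: span_submodule.
  move=> _ /allpairsP [[u v] /= [us vt ->]].
  by apply: mem_mul_sub; exact: mem_span.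
Qed.

Lemma exp_sub_ideal A n : ideal A -> ideal (exp_sub A n).
Proof.
move=> idA; elim: n => [|n [_ ?]]; first exact: dom_ideal.
exact: mul_sub_ideal.
Qed.

Lemma exp_sub1 A : submodule A -> exp_sub A 1 = A.
Proof.
move=> sA; apply/seteqP; split; first exact: mul_sub_subl.
by move=> x Ax; rewrite -[x]mulr1; apply: mem_mul_sub => //; exact: dom1.
Qed.

(** The inclusion of I^(m+n) in I^m I^n, in the form of an elimination
principle: quantifying over the target submodule lets the induction on m
absorb the extra factor into the target. *)
Lemma exp_subD_min A m n G : submodule G ->
  (forall x y, exp_sub A m x -> exp_sub A n y -> G (x * y)) ->
  exp_sub A (m + n) `<=` G.
Proof.
elim: m G => [|m IH] G sG GM.
  by move=> x Ax; rewrite -[x]mul1r; apply: GM => //; exact: dom1.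
apply: mul_sub_min; [exact: submodule0 | by move=> x y; exact: submoduleD |].
move=> a z Aa; apply: (IH [set z | G (a * z)]); first exact: preim_submodule.
by move=> x y Ax Ay /=; rewrite mulrA; apply: GM => //; exact: mem_mul_sub.
Qed.

Lemma fractional_ideal A : ideal A -> nonzero A -> fractional A.
Proof.
move=> [sA AD] nA; split=> //; exists 1; first exact: oner_neq0.
by move=> x /AD; rewrite tofrac1 mul1r.
Qed.

Lemma dom_nonzero : nonzero D.
Proof. by exists 1; [exact: dom1 | exact: oner_neq0]. Qed.

Lemma dom_fractional : fractional D.
Proof. by apply: fractional_ideal; [exact: dom_ideal | exact: dom_nonzero]. Qed.

Lemma sub_nonzero A B : A `<=` B -> nonzero A -> nonzero B.
Proof. by move=> AB [x /AB Bx x0]; exists x. Qed.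

Lemma frac_denom x : exists2 d : R, d != 0 & D (tofrac d * x).
Proof.
elim/quotW: x => q; exists q.2; first exact: denom_ratioP.
exists q.1 => //; unlock tofrac; rewrite -[RHS]FracField.pi_mul.
apply/eqmodP; rewrite /= FracField.equivfE /FracField.mulf.
by rewrite !numden_Ratio ?(mulf_neq0, oner_eq0, denom_ratioP) // !mul1r mulrC.
Qed.

Lemma scale_fractional c A : c != 0 -> fractional A -> fractional (scale_sub c A).
Proof.
move=> c0 [sA [x Ax x0] [d d0 Ad]]; split; first exact: scale_submodule.
- by exists (c * x); [exists x | rewrite mulf_neq0].
- have [e e0 De] := frac_denom c; exists (e * d); first by rewrite mulf_neq0.
  move=> _ [u Au <-]; rewrite tofracM mulrACA; apply: domM => //; exact: Ad.
Qed.

Lemma inv_sub_ideal1 A : A `<=` D -> inv_sub A 1.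
Proof. by move=> AD x /AD; rewrite mul1r. Qed.

Lemma mul_inv_ideal A : ideal A -> ideal (mul_sub A (inv_sub A)).
Proof.
move=> [sA _]; split; first exact: mul_sub_submodule.
apply: mul_sub_min; [exact: dom0 | exact: domD |].
by move=> x y Ax /(_ _ Ax); rewrite mulrC.
Qed.

Lemma sub_mul_inv A : A `<=` D -> A `<=` mul_sub A (inv_sub A).
Proof.
move=> AD x Ax; rewrite -[x]mulr1; apply: mem_mul_sub => //.
exact: inv_sub_ideal1.
Qed.

End Submodules.

(** * Maximal star-ideals *)

Section MaximalStarIdeals.
Variables (R : idomainType) (star : star_operation R).
Hypothesis star_ft : finite_type star.
Local Notation K := {fraction R}.
Local Notation D := (dom R).
Implicit Types (A B C I J M N : set K) (x y : K).

Lemma star_ideal_star A : ideal A -> nonzero A -> star_ideal star (star A).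
Proof.
move=> idA nA; have fA := fractional_ideal idA nA.
have [sS nS _] := star_fractional star fA.
split=> //; last exact: star_idem.
split=> //; rewrite -(star_dom star).
by apply: star_mono => //; [exact: dom_fractional | case: idA].
Qed.

Lemma star_ideal_fractional N : star_ideal star N -> fractional N.
Proof. by case=> idN nN _; exact: fractional_ideal. Qed.

Lemma star_dom_ideal : star_ideal star D.
Proof. by split; [exact: dom_ideal | exact: dom_nonzero | exact: star_dom]. Qed.

(** Star closure commutes with scaling, so y A inside B means that A is inside
y^-1 B, which is closed whenever B is. *)
Lemma star_colon A B y : fractional A -> star_ideal star B ->
  (forall x, A x -> B (y * x)) -> forall x, star A x -> B (y * x).
Proof.
move=> fA siB AB x Sx; have [[sB _] _ SB] := siB.
have [->|y0] := eqVneq y 0; first by rewrite mul0r; exact: submodule0.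
have fB := star_ideal_fractional siB.
have y'0 : y^-1 != 0 by rewrite invr_eq0.
have : star (scale_sub y^-1 B) x.
  apply: (star_mono fA _ _ Sx); first exact: scale_fractional.
  by move=> z Az; exists (y * z); [exact: AB | rewrite mulKf].
by rewrite star_scale // SB => -[z Bz <-]; rewrite mulVKf.
Qed.

Lemma star_min A N : fractional A -> star_ideal star N -> A `<=` N ->
  star A `<=` N.
Proof.
by move=> fA siN AN; have [_ _ <-] := siN; apply: star_mono => //;
  exact: star_ideal_fractional.
Qed.

(** The point where finite type is used: the star closure of the union is
covered by the closures of finitely generated subideals, and the generators of
such a subideal all lie in one member of the chain. *)
Lemma star_ideal_chain (F : set (set K)) :
  F !=set0 -> total_on F subset ->
  (forall N, F N -> star_ideal star N /\ N <> D) ->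
  star_ideal star (\bigcup_(N in F) N) /\ \bigcup_(N in F) N <> D.
Proof.
move=> [N0 FN0] totF propF; set U := \bigcup_(N in F) N.
have pairF x y : U x -> U y -> exists2 N, F N & N x /\ N y.
  move=> [N1 F1 N1x] [N2 F2 N2y].
  case: (totF _ _ F1 F2) => [le|le].
  - by exists N2 => //; split=> //; exact: le.
  - by exists N1 => //; split=> //; exact: le.
have idF N : F N -> ideal N by move=> /propF [[]].
have idU : ideal U.
  split; last by move=> x [N /idF [_ ND] /ND].
  split; first by exists N0 => //; have [sN _] := idF _ FN0; exact: submodule0.
  - move=> x y Ux Uy; have [N FN [Nx Ny]] := pairF _ _ Ux Uy.
    by exists N => //; have [sN _] := idF _ FN; exact: submoduleD.
  - move=> a x [N FN Nx]; exists N => //.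
    by apply: idealM => //; [exact: idF | exact: dom_tofrac].
have nU : nonzero U.
  have [[_ nN _] _] := propF _ FN0.
  by apply: sub_nonzero nN => x Nx; exists N0.
have finF (s : seq K) : (forall x, x \in s -> U x) ->
    exists2 N, F N & forall x, x \in s -> N x.
  elim: s => [_|a s IH Us]; first by exists N0.
  have [|N1 F1 N1s] := IH; first by move=> x xs; apply: Us; rewrite inE xs orbT.
  have [N2 F2 N2a] := Us a (mem_head _ _).
  case: (totF _ _ F1 F2) => [le|le].
  - exists N2 => // x; rewrite inE => /orP[/eqP -> //|/N1s]; exact: le.
  - exists N1 => // x; rewrite inE => /orP[/eqP ->|/N1s //]; exact: le.
split; last first.
  move=> UD; have [N FN N1] : U 1 by rewrite UD; exact: dom1.
  by have [_] := propF _ FN; apply; apply: ideal_eq_dom => //; exact: idF.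
split=> //; apply/seteqP; split; last first.
  by apply: star_ext; exact: fractional_ideal.
rewrite (star_ft (fractional_ideal idU nU)) => z [_ [[s ->] nJ JU] Sz].
have [|N FN Ns] := finF s; first by move=> x /mem_span; exact: JU.
have [siN _] := propF _ FN; have [[sN ND] _ _] := siN.
have JN : span_sub s `<=` N by exact: span_min.
exists N => //; apply: (star_min _ siN JN) Sz.
apply: fractional_ideal => //; split; first exact: span_submodule.
exact: subset_trans JN ND.
Qed.

(** If the star closure of A were proper, Zorn's lemma applied to the proper
star-ideals containing A would put A in a maximal star-ideal. *)
Lemma star_eq_dom A : ideal A -> nonzero A ->
  (forall N, maximal_star_ideal star N -> ~ (A `<=` N)) -> star A = D.
Proof.
move=> idA nA noN; apply: contrapT => SD.
pose proper N := [/\ star_ideal star N, N <> D & A `<=` N].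
(* The empty set is added because the empty chain has an empty union. *)
pose P N := N = set0 \/ proper N.
have properS : proper (star A).
  split=> //; first exact: star_ideal_star.
  by apply: star_ext; exact: fractional_ideal.
have [F FP totF|N [PN maxN]] := @Zorn_bigcup K P.
  have [[N0 [FN0 N00]]|F0] := pselect (exists N, F N /\ N <> set0); last first.
    left; apply/seteqP; split=> // x [N FN Nx]; case: F0; exists N; split=> //.
    by move=> N0; rewrite N0 in Nx.
  right; pose G : set (set K) := [set N | F N /\ proper N].
  have GN0 : G N0 by split=> //; case: (FP _ FN0).
  have -> : \bigcup_(N in F) N = \bigcup_(N in G) N.
    apply/seteqP; split=> x [N FN Nx]; last by exists N => //; case: FN.
    by exists N => //; split=> //; case: (FP _ FN) => // N1; rewrite N1 in Nx.
  have [|||siU pU] := @star_ideal_chain G.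
  - by exists N0.
  - by move=> N1 N2 [F1 _] [F2 _]; exact: totF.
  - by move=> N [_ []].
  - split=> //; have [_ [_ _ AN0]] := GN0.
    by move=> x /AN0 N0x; exists N0.
have {PN} [siN pN AN] : proper N.
  case: PN => // N0; case: (maxN (star A)); last by right.
  rewrite N0; split=> // SA0; have [[[[SA _ _] _] _ _] _ _] := properS.
  by have := SA0 _ SA.
apply: (noN N) => //; split=> // N' siN' pN' NN'.
apply: contrapT => N'N; apply: (maxN N').
  split=> // N'leN; apply: N'N; apply/seteqP; split=> //.
by right; split=> //; exact: subset_trans AN NN'.
Qed.

Variable M : set K.
Hypothesis maxM : maximal_star_ideal star M.

Lemma maximal_star_ideal_star : star_ideal star M.
Proof. by case: maxM. Qed.

Lemma maximal_star_ideal_ideal : ideal M.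
Proof. by case: maximal_star_ideal_star. Qed.

Lemma maximal_star_ideal_not1 : ~ M 1.
Proof.
case: maxM => _ MD _ M1; apply: MD; apply: ideal_eq_dom => //.
exact: maximal_star_ideal_ideal.
Qed.

(** If x is outside M, the star closure of M + xR is R by maximality, while
multiplication by y maps M + xR into M as soon as xy lies in M. *)
Lemma maximal_star_ideal_prime x y : D x -> D y -> M (x * y) -> M x \/ M y.
Proof.
move=> Dx Dy Mxy; have [Mx|nMx] := pselect (M x); [by left | right].
have siM := maximal_star_ideal_star; have [idM nM _] := siM.
have idN : ideal (add_sub M (principal x)).
  by apply: add_sub_ideal => //; exact: principal_ideal.
have MN : M `<=` add_sub M (principal x).
  by apply: add_subl; exact: principal_submodule.
have nN := sub_nonzero MN nM.
have fN := fractional_ideal idN nN.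
have SN : star (add_sub M (principal x)) = D.
  have [_ _ maxM'] := maxM; apply: contrapT => SND; apply: nMx.
  rewrite -(maxM' (star (add_sub M (principal x)))) //.
  - apply: star_ext => //; apply: add_subr; last exact: mem_principal.
    by case: idM.
  - exact: star_ideal_star.
  - by apply: (subset_trans MN); exact: star_ext.
rewrite -[y]mulr1; apply: (star_colon fN siM); last by rewrite SN; exact: dom1.
move=> _ [m [_ [Mm [r Dr <-] ->]]]; rewrite mulrDr.
apply: submoduleD; first by case: idM.
- exact: idealM.
- have -> : y * (r * x) = r * (x * y) by ring.
  exact: idealM.
Qed.

End MaximalStarIdeals.

(** * Super rigidity as a local condition at M *)

Section Local.
Variables (R : idomainType) (star : star_operation R).
Hypothesis star_ft : finite_type star.
Local Notation K := {fraction R}.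
Local Notation D := (dom R).
Implicit Types (A B C I J M N P S : set K) (x y : K).

(** Vacuously true of an ideal in no maximal star-ideal.  This makes it inherited
by every larger ideal ([supported_atS]), including those whose star closure is
R. *)
Definition supported_at M J : Prop :=
  forall N, maximal_star_ideal star N -> J `<=` N -> N = M.

Definition invertible_at M C : Prop :=
  exists c y, [/\ C c, inv_sub C y & ~ M (c * y)].

(** Super rigidity with star-invertibility replaced by invertibility at M, so
that star enters only through the maximal star-ideals above I. *)
Definition super_rigid_at M I : Prop :=
  [/\ ideal I, nonzero I, fin_gen I, supported_at M I
    & forall J, ideal J -> fin_gen J -> I `<=` J -> invertible_at M J].

Lemma supported_atS M I J : I `<=` J -> supported_at M I -> supported_at M J.
Proof. by move=> IJ supI N maxN JN; apply: supI => //; exact: subset_trans IJ JN. Qed.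

Variable M : set K.
Hypothesis maxM : maximal_star_ideal star M.
Let idM := maximal_star_ideal_ideal maxM.
Let subM : submodule M. Proof. by case: idM. Qed.
Let siM := maximal_star_ideal_star maxM.
Let primeM := maximal_star_ideal_prime maxM.

(** For an ideal that only M can contain, star closure is detected at M: the
ideal of all r with x r in J contains both J and u, hence lies in no maximal
star-ideal. *)
Lemma mem_star_of_local J x u : ideal J -> nonzero J -> supported_at M J ->
  D x -> D u -> ~ M u -> J (u * x) -> star J x.
Proof.
move=> idJ nJ supJ Dx Du nMu Jux; have [sJ JD] := idJ.
pose A : set K := [set r | D r] `&` [set r | J (x * r)].
have JA : J `<=` A by move=> r Jr; split; [exact: JD | exact: idealM].
have idA : ideal A.
  split; last by move=> r [].
  have [p0 pD pM] := preim_submodule x sJ.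
  split; first by split=> //; exact: dom0.
  - by move=> r s [? ?] [? ?]; split; [exact: domD | exact: pD].
  - move=> a r [? ?]; split; last exact: pM.
    by apply: domM => //; exact: dom_tofrac.
have nA := sub_nonzero JA nJ.
have fJ := fractional_ideal idJ nJ.
have SA : star A = D.
  apply: star_eq_dom => // N maxN AN; apply: nMu.
  rewrite -(supJ N) //; last exact: subset_trans JA AN.
  by apply: AN; split=> //=; rewrite mulrC.
rewrite -[x]mulr1; apply: (star_colon (fractional_ideal idA nA)).
- exact: star_ideal_star.
- by move=> r [_ /= Jxr]; apply: star_ext.
- by rewrite SA; exact: dom1.
Qed.

Lemma star_invertible_at C : star_invertible star C -> invertible_at M C.
Proof.
move=> [idC nC SC]; apply: contrapT => notinv.
apply: (maximal_star_ideal_not1 maxM).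
have CM : mul_sub C (inv_sub C) `<=` M.
  apply: mul_sub_min; [exact: submodule0 | by move=> x y; exact: submoduleD |].
  by move=> c y Cc Iy; apply: contrapT => nM; apply: notinv; exists c, y.
apply: (star_min _ siM CM); last by rewrite SC; exact: dom1.
apply: fractional_ideal; first exact: mul_inv_ideal.
by apply: sub_nonzero nC; apply: sub_mul_inv; case: idC.
Qed.

Lemma invertible_at_star C : ideal C -> nonzero C -> supported_at M C ->
  invertible_at M C -> star_invertible star C.
Proof.
move=> idC nC supC [c [y [Cc Iy nM]]].
have leC : C `<=` mul_sub C (inv_sub C) by apply: sub_mul_inv; case: idC.
split=> //; apply: star_eq_dom => //.
- exact: mul_inv_ideal.
- exact: sub_nonzero nC.
- move=> N maxN CN; apply: nM; rewrite -(supC N) //.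
  + by apply: CN; exact: mem_mul_sub.
  + exact: subset_trans leC CN.
Qed.

Lemma super_rigid_atE I :
  super_rigid_at M I /\ I `<=` M <-> star_super_rigid star I /\ I `<=` M.
Proof.
split=> [[[idI nI fI supI invI] IM]|[[[idI nI fI [N [_ uniqN]]] invI] IM]].
- split=> //; split.
    by split=> //; exists M; split=> // N [maxN IN]; apply/esym/supI.
  move=> J idJ fJ IJ; apply: invertible_at_star => //.
  + exact: sub_nonzero nI.
  + exact: supported_atS supI.
  + exact: invI.
- split=> //; split=> //.
  + by move=> N' maxN' IN'; rewrite -(uniqN N') // -(uniqN M).
  + by move=> J idJ fJ IJ; apply/star_invertible_at/invI.
Qed.

(** Locally at M, S lies in aR as soon as a is not in the closure of S: the
ideal S + aR is generated at M by one of its two summands, and S is excluded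
by [mem_star_of_local]. *)
Lemma super_rigid_at_mul_sub_principal S a :
  super_rigid_at M S -> D a -> ~ star S a ->
  exists u, [/\ D u, ~ M u & forall s, S s -> principal a (u * s)].
Proof.
move=> [idS nS fgS supS invS] Da nSa.
have [|||c [y [[s [_ [Ss [r Dr <-] ->]]] Cy nM]]] :=
    invS (add_sub S (principal a)).
- by apply: add_sub_ideal => //; exact: principal_ideal.
- by apply: fin_gen_add => //; exact: fin_gen_principal.
- by apply: add_subl; exact: principal_submodule.
have sS : submodule S by case: idS.
have Dya : D (y * a).
  by apply: Cy; apply: add_subr => //; exact: mem_principal.
have Dys t : S t -> D (y * t).
  by move=> St; apply: Cy; apply: add_subl => //; exact: principal_submodule.
have [Mya|nMya] := pselect (M (y * a)); last first.
  exists (y * a); split=> // t St; exists (y * t); [exact: Dys | ring].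
case: nSa; apply: (@mem_star_of_local _ _ (y * s)) => //; first exact: Dys.
- move=> Mys; apply: nM; rewrite mulrDl; apply: submoduleD => //.
  + by rewrite mulrC.
  + have -> : r * a * y = r * (y * a) by ring.
    exact: idealM.
- have -> : y * s * a = y * a * s by ring.
  exact: idealM.
Qed.

(** One element x of A outside the closure of I suffices: up to a factor outside
M, it divides every element of I. *)
Lemma super_rigid_at_comparable I A :
  super_rigid_at M I -> ideal A -> nonzero A -> supported_at M A ->
  I `<=` star A \/ A `<=` star I.
Proof.
move=> srI idA nA supA; have [[_ ID] _ _ _ _] := srI.
have [AI|nAI] := pselect (A `<=` star I); [by right | left=> i Ii].
have [x [Ax nIx]] : exists x, A x /\ ~ star I x.
  by apply: contrapT => h; apply: nAI => x Ax; apply: contrapT => ?; apply: h; exists x.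
have [sA AD] := idA.
have [u [Du nMu uI]] := super_rigid_at_mul_sub_principal srI (AD _ Ax) nIx.
apply: (mem_star_of_local idA nA supA (ID _ Ii) Du nMu).
by apply: (principal_min sA Ax); exact: uI.
Qed.


(** A finitely generated B containing A has I inside its closure.  If no element
of B were to witness invertibility at M, then an inverse y of I + B would map B,
hence the closure of B, hence I, into M, and so all of I + B. *)
Lemma super_rigid_at_of_star I A :
  super_rigid_at M I -> ideal A -> nonzero A -> fin_gen A -> I `<=` star A ->
  super_rigid_at M A.
Proof.
move=> [idI nI fgI supI invI] idA nA fgA IA.
have fA := fractional_ideal idA nA.
split=> //.
  move=> N maxN AN; apply: supI => //; apply: (subset_trans IA).
  by apply: star_min => //; exact: maximal_star_ideal_star.
move=> B idB fgB AB; have [sB BD] := idB; have [sI ID] := idI.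
have fB := fractional_ideal idB (sub_nonzero AB nA).
have [|||c [y [[i [b [Ii Bb ->]]] Cy nM]]] := invI (add_sub I B).
- exact: add_sub_ideal.
- exact: fin_gen_add.
- exact: add_subl.
have By : inv_sub B y by move=> z Bz; apply: Cy; apply: add_subr.
apply: contrapT => notinv; apply: nM.
have yBM z : B z -> M (y * z).
  move=> Bz; apply: contrapT => nM; apply: notinv.
  by exists z, y; rewrite mulrC.
rewrite mulrC mulrDr; apply: submoduleD => //; last exact: yBM.
apply: (star_colon fB siM yBM).
by apply: (star_mono fA fB AB); exact: IA.
Qed.

Lemma star_neq_dom_sub A : ideal A -> nonzero A -> star A <> D ->
  supported_at M A -> A `<=` M.
Proof.
move=> idA nA SA supA; apply: contrapT => nAM; apply: SA.
by apply: star_eq_dom => // N maxN AN; apply: nAM; rewrite -(supA N).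
Qed.

(** Let C contain IJ.  By comparability with I, either I is inside the closure of
C, which settles the matter, or C is inside the closure of I.  In the latter
case an inverse y of I at M carries C to an integral ideal, and J + yC inherits
invertibility at M from J.  Whichever summand provides the witness, it yields
one for C: if it is J, multiply by i y, which is outside M. *)
Lemma super_rigid_at_mul I J :
  super_rigid_at M I -> super_rigid_at M J -> super_rigid_at M (mul_sub I J).
Proof.
move=> srI srJ; have [idI nI fgI supI invI] := srI.
have [idJ nJ fgJ supJ invJ] := srJ.
have [sI ID] := idI; have [sJ JD] := idJ.
have idIJ : ideal (mul_sub I J) by exact: mul_sub_ideal.
have nIJ := mul_sub_nonzero nI nJ.
have supIJ : supported_at M (mul_sub I J).
  move=> N maxN IJN; have [sN _] := maximal_star_ideal_ideal maxN.
  have [IN|nIN] := pselect (I `<=` N); first exact: supI.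
  apply: supJ => // j Jj; apply: contrapT => nNj; apply: nIN => i Ii.
  have [] // := maximal_star_ideal_prime maxN (ID _ Ii) (JD _ Jj).
  by apply: IJN; exact: mem_mul_sub.
split=> //; first exact: fin_gen_mul.
move=> C idC fgC IJC; have nC := sub_nonzero IJC nIJ; have [sC CD] := idC.
have supC := supported_atS IJC supIJ.
have [IC|CI] := super_rigid_at_comparable srI idC nC supC.
  by have [_ _ _ _] := super_rigid_at_of_star srI idC nC fgC IC; apply.
have [i [y [Ii Iy nMiy]]] := invI I idI fgI (@subset_refl _ I).
have yCD : scale_sub y C `<=` D.
  move=> _ [c Cc <-].
  apply: (star_colon (fractional_ideal idI nI) (star_dom_ideal star) Iy).
  exact: CI.
have idyC : ideal (scale_sub y C) by split=> //; exact: scale_submodule.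
have [|||b [z [[j [_ [Jj [c Cc <-] ->]]] Bz nM]]] :=
    invJ (add_sub J (scale_sub y C)).
- exact: add_sub_ideal.
- by apply: fin_gen_add => //; exact: fin_gen_scale.
- by apply: add_subl; case: idyC.
have Cyz : inv_sub C (y * z).
  move=> x Cx; have -> : y * z * x = z * (y * x) by ring.
  by apply: Bz; apply: add_subr => //; exists x.
have [Mcyz|nMcyz] := pselect (M (c * (y * z))); last by exists c, (y * z).
exists (i * j), (y * z); split=> //; first by apply: IJC; exact: mem_mul_sub.
have Diy : D (i * y) by rewrite mulrC; exact: Iy.
have Djz : D (j * z) by rewrite mulrC; apply: Bz; apply: add_subl => //; case: idyC.
have -> : i * j * (y * z) = i * y * (j * z) by ring.
move=> /(primeM Diy Djz) [//|Mjz]; apply: nM; rewrite mulrDl.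
apply: submoduleD => //.
by have -> : y * c * z = c * (y * z) by ring.
Qed.

Lemma super_rigid_at_exp I n :
  super_rigid_at M I -> super_rigid_at M (exp_sub I n.+1).
Proof.
move=> srI; elim: n => [|n IH]; last exact: super_rigid_at_mul.
by rewrite exp_sub1 //; case: srI => -[].
Qed.

(** An inverse of I at M turns x in the closure of I into the fraction
i (y x) / (i y), whose denominator is outside M; conversely, a common
denominator of an element of I R_M is the u of [mem_star_of_local]. *)
Lemma star_eq_localization I : super_rigid_at M I ->
  star I = mul_sub I (localization M) `&` D.
Proof.
move=> [idI nI fgI supI invI]; have [sI ID] := idI.
have fI := fractional_ideal idI nI.
apply/seteqP; split=> x.
  move=> Sx; have Dx : D x by case: (star_ideal_star star idI nI) => -[_ SD] _ _; exact: SD.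
  split=> //; have [i [y [Ii Iy nM]]] := invI I idI fgI (@subset_refl _ I).
  have [a _ aE] : D (y * x) := star_colon fI (star_dom_ideal star) Iy Sx.
  have [d _ dE] : D (i * y) by rewrite mulrC; exact: Iy.
  have nMd : ~ M (tofrac d) by rewrite dE.
  have -> : x = i * (tofrac a / tofrac d).
    have iy0 : i * y != 0.
      by apply/eqP => iy0; apply: nM; rewrite iy0; exact: submodule0.
    by rewrite aE dE mulrA [i * _]mulrA mulrAC mulfV // mul1r.
  by apply: mem_mul_sub => //; exists a, d.
move=> [Ix Dx].
have [u [Du nMu Iux]] : exists u, [/\ D u, ~ M u & I (u * x)].
  pose G : set K := [set z | exists u, [/\ D u, ~ M u & I (u * z)]].
  apply: (@mul_sub_min _ I (localization M) G) Ix; rewrite /G /=.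
  - exists 1; rewrite mulr0; split; [exact: dom1 | | exact: submodule0].
    exact: maximal_star_ideal_not1 maxM.
  - move=> y z [u [Du nMu Iuy]] [v [Dv nMv Ivz]]; exists (u * v); split.
    + exact: domM.
    + by move=> /(primeM Du Dv) [].
    + have -> : u * v * (y + z) = v * (u * y) + u * (v * z) by ring.
      by apply: submoduleD => //; exact: idealM.
  - move=> i _ Ii [a [d [nMd ->]]]; exists (tofrac d).
    split=> //; first exact: dom_tofrac.
    have d0 : tofrac d != 0 by apply/eqP => d0; apply: nMd; rewrite d0; exact: submodule0.
    have -> : tofrac d * (i * (tofrac a / tofrac d)) = tofrac a * i.
      by rewrite mulrCA [tofrac d * _]mulrC divfK // mulrC.
    by apply: idealM => //; exact: dom_tofrac.
exact: mem_star_of_local Iux.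
Qed.

Lemma star_exp_sub_M I n : super_rigid_at M I -> I `<=` M ->
  star (exp_sub I n.+1) `<=` M.
Proof.
move=> srI IM; have [idE nE _ _ _] := super_rigid_at_exp n srI.
have [idI _ _ _ _] := srI.
apply: star_min => //; first exact: fractional_ideal.
apply: (subset_trans _ IM); apply: mul_sub_subl; first by case: idI.
by case: (exp_sub_ideal n idI).
Qed.

(** If a is outside the closure of I^m and b outside that of I^n, then uv I^k
lies in abR for k = m + n and some u, v outside M.  With ab in the
intersection, cancelling I^k at M from the inclusion of uv I^k in the closure
of I^(k+1) puts uv in the closure of I, hence in M. *)
Lemma bigcap_star_exp_prime I : super_rigid_at M I -> I `<=` M ->
  prime_ideal (\bigcap_(n in [set n : nat | (0 < n)%N]) star (exp_sub I n)).
Proof.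
move=> srI IM; set Q := \bigcap_(n in _) _.
have idI : ideal I by case: srI.
have idE n : ideal (exp_sub I n) := exp_sub_ideal n idI.
have idS n : ideal (star (exp_sub I n.+1)).
  by have [? ? _ _ _] := super_rigid_at_exp n srI; case: (star_ideal_star star (A := exp_sub I n.+1)).
have idQ : ideal Q.
  split; last by move=> x /(_ 1%N isT); case: (idS 0%N) => _; apply.
  split.
  - by case=> // n _; case: (idS n) => s _; exact: submodule0.
  - move=> x y Qx Qy [|n] // n0; case: (idS n) => s _.
    by apply: submoduleD => //; [exact: Qx | exact: Qy].
  - move=> a x Qx [|n] // n0; apply: (idealM (idS n)); [exact: dom_tofrac | exact: Qx].
split=> //.
  move=> QD; apply: (maximal_star_ideal_not1 maxM).
  have /(_ 1%N isT) : Q 1 by rewrite QD; exact: dom1.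
  exact: star_exp_sub_M.
move=> a b Da Db Qab; apply: contrapT => /not_orP [nQa nQb].
have notQ c : ~ Q c -> exists n, ~ star (exp_sub I n.+1) c.
  move=> nQ; apply: contrapT => h; apply: nQ => -[|n] // _.
  by apply: contrapT => ?; apply: h; exists n.
have [m na] := notQ _ nQa; have [n nb] := notQ _ nQb.
have [u [Du nMu uE]] := super_rigid_at_mul_sub_principal (super_rigid_at_exp m srI) Da na.
have [v [Dv nMv vE]] := super_rigid_at_mul_sub_principal (super_rigid_at_exp n srI) Db nb.
(* Exponents are shifted by one: a avoids the closure of I^(m+1) and b that of
   I^(n+1), and k.+1 = m.+1 + n.+1. *)
pose k := (m + n.+1)%N.
have srk : super_rigid_at M (exp_sub I k.+1) by exact: super_rigid_at_exp.
have wE x : exp_sub I k.+1 x -> Q (u * v * x).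
  have [sQ _] := idQ.
  apply: (@exp_subD_min _ I m.+1 n.+1 [set x | Q (u * v * x)]).
    exact: preim_submodule.
  move=> y z /uE [r Dr ry] /vE [s Ds sz] /=.
  have -> : u * v * (y * z) = (u * y) * (v * z) by ring.
  rewrite -ry -sz; have -> : r * a * (s * b) = r * s * (a * b) by ring.
  by apply: (idealM idQ) => //; exact: domM.
have [idk nk fgk supk invk] := srk.
have [x [y [Ex Ey nM]]] := invk _ idk fgk (@subset_refl _ _).
have Dxy : D (x * y) by rewrite mulrC; exact: Ey.
have : M (y * (u * v * x)).
  (* The inverse y of I^(k+1) maps I^(k+2) into I, hence its closure into M. *)
  have [idk1 nk1 _ _ _] := super_rigid_at_exp k.+1 srI.
  apply: (star_colon (fractional_ideal idk1 nk1) siM); last exact: (wE _ Ex k.+2).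
  apply: (@mul_sub_min _ _ _ [set z | M (y * z)]).
  - by rewrite /= mulr0; exact: submodule0.
  - by move=> z t /= ? ?; rewrite mulrDr; exact: submoduleD.
  - move=> i z Ii Ez /=; have -> : y * (i * z) = y * z * i by ring.
    by apply: idealM; [exact: idM | exact: Ey | exact: IM].
have -> : y * (u * v * x) = u * v * (x * y) by ring.
move=> /(primeM (domM Du Dv) Dxy) [|//].
by move=> /(primeM Du Dv) [].
Qed.

(** For p in P outside the closure of I^n, some u outside M maps I^n into pR,
hence into P; an element i of I outside P then has u i^n in P, although neither
u nor i lies in P. *)
Lemma prime_sub_bigcap_star_exp I P : super_rigid_at M I ->
  prime_ideal P -> P `<=` M -> ~ (I `<=` P) ->
  P `<=` \bigcap_(n in [set n : nat | (0 < n)%N]) star (exp_sub I n).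
Proof.
move=> srI [idP _ primeP] PM nIP p Pp [//|n] _; apply: contrapT => nEp.
have [sP PD] := idP; have idI : ideal I by case: srI.
have [sI ID] := idI.
have [u [Du nMu uE]] :=
  super_rigid_at_mul_sub_principal (super_rigid_at_exp n srI) (PD _ Pp) nEp.
have [i [Ii nPi]] : exists i, I i /\ ~ P i.
  apply: contrapT => h; apply: nIP => i Ii.
  by apply: contrapT => ?; apply: h; exists i.
have Di k : D (i ^+ k).
  by elim: k => [|k IH]; [exact: dom1 | rewrite exprS; apply: domM => //; exact: ID].
have nPik k : ~ P (i ^+ k.+1).
  elim: k => [|k IH]; first by rewrite expr1.
  by rewrite exprS => /(primeP _ _ (ID _ Ii) (Di _)) [].
have Eik k : exp_sub I k (i ^+ k).
  elim: k => [|k IH]; first exact: dom1.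
  by rewrite exprS; exact: mem_mul_sub.
have := principal_min sP Pp (uE _ (Eik n.+1)).
by move=> /(primeP _ _ Du (Di _)) [/PM|/nPik].
Qed.

End Local.

(** * The identity star operation on a local domain *)

Section LocalDomain.
Variable R : idomainType.
Local Notation K := {fraction R}.
Local Notation D := (dom R).
Implicit Types (A I M N : set K).

Definition identity_star : star_operation R :=
  @StarOperation R id (fun _ fA => fA) (fun _ _ _ _ => erefl) erefl
    (fun A _ => @subset_refl _ A) (fun _ _ _ _ AB => AB) (fun _ _ => erefl).

Lemma identity_star_finite_type : finite_type identity_star.
Proof.
move=> A [sA [c Ac c0] _]; apply/seteqP; split=> [x Ax|x [J [_ _ JA] /JA]//].
exists (add_sub (principal c) (principal x)).
  split.
  - by apply: fin_gen_add; exact: fin_gen_principal.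
  - exists c => //; apply: add_subl; first exact: principal_submodule.
    exact: mem_principal.
  - move=> _ [y [z [cy xz ->]]].
    by apply: submoduleD => //; [exact: principal_min cy | exact: principal_min xz].
by apply: add_subr; [exact: principal_submodule | exact: mem_principal].
Qed.

Lemma maximal_identity_star_ideal N :
  maximal_star_ideal identity_star N -> maximal_ideal N.
Proof.
move=> [[idN nN _] ND maxN]; split=> // N' idN' ND' NN'.
by apply: maxN => //; split=> //; exact: sub_nonzero nN.
Qed.

Variable M : set K.
Hypothesis locM : local_with_maximal_ideal M.

Lemma local_maximal_identity_star : nonzero M -> maximal_star_ideal identity_star M.
Proof.
move=> nM; have [idM MD maxM] : maximal_ideal M by apply/locM.
by split=> // N [idN _ _]; exact: maxM.
Qed.

(** In a local domain the support condition is automatic, which is why (5)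
compares I with every ideal. *)
Lemma local_supported_at A : supported_at identity_star M A.
Proof. by move=> N /maximal_identity_star_ideal /locM. Qed.

Lemma local_super_rigid_at (star : star_operation R) I :
  super_rigid_at star M I -> super_rigid_at identity_star M I.
Proof. by case=> idI nI fgI _ invI; split=> //; exact: local_supported_at. Qed.

End LocalDomain.

(** * Properties of star-super rigid ideals *)

Theorem theorem1p11 (R : idomainType) (star : star_operation R)
    (star_ft : finite_type star)
    (M : set {fraction R}) (M_sp : star_super_potent star M)
    (I : set {fraction R}) (I_sr : star_super_rigid star I) (I_M : I `<=` M) :
  (* (1) *)
  (forall A : set {fraction R}, ideal A -> nonzero A -> fin_gen A ->
     star A <> dom R -> I `<=` star A -> star_super_rigid star A) /\
  (* (2) *)
  (forall J : set {fraction R}, star_super_rigid star J -> J `<=` M ->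
     I `<=` star J \/ J `<=` star I) /\
  (* (3) *)
  (forall J : set {fraction R}, star_super_rigid star J -> J `<=` M ->
     star_super_rigid star (mul_sub I J)) /\
  (* (4) *)
  (forall n : nat, (0 < n)%N -> star_super_rigid star (exp_sub I n)) /\
  (* (5) *)
  (local_with_maximal_ideal M ->
     (forall A : set {fraction R}, ideal A -> I `<=` A \/ A `<=` I) /\
     prime_ideal (\bigcap_(n in [set n : nat | (0 < n)%N]) exp_sub I n)) /\
  (* (6) *)
  star I = mul_sub I (localization M) `&` dom R /\
  (* (7) *)
  prime_ideal (\bigcap_(n in [set n : nat | (0 < n)%N]) star (exp_sub I n)) /\
  (* (8) *)
  (forall P : set {fraction R}, prime_ideal P -> P `<=` M -> ~ (I `<=` P) ->
     P `<=` \bigcap_(n in [set n : nat | (0 < n)%N]) star (exp_sub I n)).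
Proof.
have [maxM _] := M_sp.
have atE := super_rigid_atE star_ft maxM.
have [srI _] := (atE I).2 (conj I_sr I_M).
have [idI nI _ _ _] := srI; have [sI _] := idI.
split; [|split; [|split; [|split; [|split; [|split; [|split]]]]]].
- move=> A idA nA fgA SA IA.
  have srA := super_rigid_at_of_star maxM srI idA nA fgA IA.
  have [_ _ _ supA _] := srA.
  have AM := star_neq_dom_sub star_ft idA nA SA supA.
  by have [] := (atE A).1 (conj srA AM).
- move=> J J_sr J_M; have [[idJ nJ _ supJ _] _] := (atE J).2 (conj J_sr J_M).
  exact: (super_rigid_at_comparable star_ft maxM srI).
- move=> J J_sr J_M; have [srJ _] := (atE J).2 (conj J_sr J_M).
  have srIJ := super_rigid_at_mul star_ft maxM srI srJ.
  have [[_ JD] _ _ _ _] := srJ.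
  by have [] := (atE _).1 (conj srIJ (subset_trans (mul_sub_subl sI JD) I_M)).
- case=> // n _; have srE := super_rigid_at_exp star_ft maxM n srI.
  have [idE nE _ _ _] := srE.
  have EM := subset_trans (star_ext star (fractional_ideal idE nE))
                          (star_exp_sub_M star_ft maxM srI I_M).
  by have [] := (atE _).1 (conj srE EM).
- move=> locM; have ftd := @identity_star_finite_type R.
  have maxdM := local_maximal_identity_star locM (sub_nonzero I_M nI).
  have srdI := local_super_rigid_at locM srI.
  split; last exact: (bigcap_star_exp_prime ftd maxdM srdI I_M).
  move=> A idA; have [nA|A0] := pselect (nonzero A).
    have supA : supported_at (identity_star R) M A by exact: local_supported_at.
    by have [IA|AI] := super_rigid_at_comparable ftd maxdM srdI idA nA supA; [left|right].
  right=> x Ax; have [->|x0] := eqVneq x 0; first exact: submodule0.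
  by case: A0; exists x.
- exact: (star_eq_localization star_ft maxM).
- exact: (bigcap_star_exp_prime star_ft maxM).
- by move=> P; exact: (prime_sub_bigcap_star_exp star_ft maxM).
Qed.
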